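(* Let $G$ be a finite group, $\alpha$ an element of $H^3_{SM}(G;U(1))$ (represented by a 3-cocycle, also denoted $\alpha$), and $\Gamma^\alpha$ the skeletal 2-group determined by $(G,U(1),\alpha)$. Then the image of $\alpha$ under the $S^1$-transgression $$\tau:Z^3(G;U(1))\longrightarrow Z^2(I(BG);U(1))$$ is determined by the horizontal composition of the 1-morphisms (strong transformations) in the higher inertia groupoid $\mathrm{PsFun}(B\mathbb{Z},B\Gamma^\alpha)$. Explicitly, for composable 1-morphisms $$(g,F^2,F^0)\xrightarrow{(h,\beta)}(g',F'^2,F'^0)\xrightarrow{(h',\beta')}(g'',F''^2,F''^0)$$ one has, for all $n\in\mathbb{Z}$ (writing $U(1)$ additively), $$(\beta'\circ\beta)_n=(\beta'_n+\beta_n)-\tau(\alpha)([h'|h]g^n).$$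
   Context: $H^*_{SM}$ is smooth Segal–Mitchison cohomology; for finite $G$, $H^3_{SM}(G;U(1))\cong H^4(BG;\mathbb{Z})$ is represented by ordinary group 3-cocycles. **The 2-group $\Gamma^\alpha$.** Objects: elements of $G$. Morphisms: $G\times U(1)$, with source and target both the projection to $G$, so the automorphism group of each object is $U(1)$. The monoidal structure is multiplication in $G$ on objects and in $G\times U(1)$ on morphisms; the associator $(g_1g_2)g_3\to g_1(g_2g_3)$ is $\alpha(g_1,g_2,g_3)\in U(1)$, and the unitors $l,r$ are those determined by $\alpha$ through the triangle identity. $B\Gamma^\alpha$ is the delooping bicategory, and $B\mathbb{Z}$ the one-object category with morphisms $\mathbb{Z}$. **Higher inertia groupoid.** $\mathrm{PsFun}(B\mathbb{Z},B\Gamma^\alpha)$ is the bicategory of pseudofunctors, strong transformations and modifications. An object is a triple $(g,\{F^2_{m,n}\},F^0)$ with $g\in G$ (the pseudofunctor sends $n\mapsto g^n$), compositors $F^2_{m,n}\in U(1)$ and unitor $F^0\in U(1)$ satisfying the pseudofunctor axioms. A 1-morphism $(g,F^2,F^0)\to(g',F'^2,F'^0)$ is a pair $(h,\{\beta_n\}_{n\in\mathbb{Z}})$ with $h\in G$ the component 1-cell, $g'h=hg$, and component 2-cells $\beta_n\in U(1)$, $\beta_n:g'^n\,h\to h\,g^n$, satisfying the axioms of a strong transformation. Composition of 1-morphisms is the standard horizontal composition of strong transformations; the composite has component 1-cell $h'h$ and component 2-cells denoted $(\beta'\circ\beta)_n$. **Transgression.** $I(BG)$ is the inertia groupoid of $BG$: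 objects $g\in G$, morphisms $h:g\to hgh^{-1}$. $[h'|h]g$ denotes the composable pair $g\xrightarrow{h}hgh^{-1}\xrightarrow{h'}h'hg(h'h)^{-1}$. The $S^1$-transgression (Willerton) of a 3-cocycle $\alpha$ is the 2-cocycle $$\tau(\alpha)([h'|h]g)=\alpha(h',h,g)-\alpha(h',hgh^{-1},h)+\alpha(h'hg(h'h)^{-1},h',h).$$ *)

(* Defs.v *)
From HB Require Import structures.
From mathcomp Require Import all_boot all_order all_algebra all_fingroup.
From mathcomp Require Import reals complex.

Set Implicit Arguments.
Unset Strict Implicit.
Unset Printing Implicit Defensive.

Import GRing.Theory Num.Theory.

Declare Scope bicat_scope.
Delimit Scope bicat_scope with bicat.
Local Open Scope bicat_scope.
Reserved Notation "g \o1 f" (at level 40, left associativity).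
Reserved Notation "b \o2 a" (at level 50, left associativity).
Reserved Notation "b \oh a" (at level 40, left associativity).

Record bicategory := Bicategory {
  obj :> Type;
  hom : obj -> obj -> Type;
  cell : forall x y, hom x y -> hom x y -> Type;
  id1 : forall x, hom x x;
  comp1 : forall x y z, hom y z -> hom x y -> hom x z;
  id2 : forall x y (f : hom x y), cell f f;
  comp2 : forall x y (f g h : hom x y), cell g h -> cell f g -> cell f h;
  hcomp : forall x y z (g g' : hom y z) (f f' : hom x y),
    cell g g' -> cell f f' -> cell (comp1 g f) (comp1 g' f');
  assoc : forall w x y z (h : hom y z) (g : hom x y) (f : hom w x),
    cell (comp1 (comp1 h g) f) (comp1 h (comp1 g f));
  assocV : forall w x y z (h : hom y z) (g : hom x y) (f : hom w x),
    cell (comp1 h (comp1 g f)) (comp1 (comp1 h g) f);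
  lunit : forall x y (f : hom x y), cell (comp1 (id1 y) f) f;
  lunitV : forall x y (f : hom x y), cell f (comp1 (id1 y) f);
  runit : forall x y (f : hom x y), cell (comp1 f (id1 x)) f;
  runitV : forall x y (f : hom x y), cell f (comp1 f (id1 x));
  comp2A : forall x y (f g h k : hom x y)
    (c : cell h k) (b : cell g h) (a : cell f g),
    comp2 c (comp2 b a) = comp2 (comp2 c b) a;
  comp21 : forall x y (f g : hom x y) (a : cell f g), comp2 a (id2 f) = a;
  comp12 : forall x y (f g : hom x y) (a : cell f g), comp2 (id2 g) a = a;
  hcomp1 : forall x y z (g : hom y z) (f : hom x y),
    hcomp (id2 g) (id2 f) = id2 (comp1 g f);
  interchange : forall x y z (g g' g'' : hom y z) (f f' f'' : hom x y)
    (b' : cell g' g'') (b : cell g g') (a' : cell f' f'') (a : cell f f'),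
    hcomp (comp2 b' b) (comp2 a' a) = comp2 (hcomp b' a') (hcomp b a);
  assoc_nat : forall w x y z (h h' : hom y z) (g g' : hom x y) (f f' : hom w x)
    (c : cell h h') (b : cell g g') (a : cell f f'),
    comp2 (assoc h' g' f') (hcomp (hcomp c b) a)
    = comp2 (hcomp c (hcomp b a)) (assoc h g f);
  lunit_nat : forall x y (f g : hom x y) (a : cell f g),
    comp2 (lunit g) (hcomp (id2 (id1 y)) a) = comp2 a (lunit f);
  runit_nat : forall x y (f g : hom x y) (a : cell f g),
    comp2 (runit g) (hcomp a (id2 (id1 x))) = comp2 a (runit f);
  assocK : forall w x y z (h : hom y z) (g : hom x y) (f : hom w x),
    comp2 (assocV h g f) (assoc h g f) = id2 (comp1 (comp1 h g) f);
  assocVK : forall w x y z (h : hom y z) (g : hom x y) (f : hom w x),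
    comp2 (assoc h g f) (assocV h g f) = id2 (comp1 h (comp1 g f));
  lunitK : forall x y (f : hom x y),
    comp2 (lunitV f) (lunit f) = id2 (comp1 (id1 y) f);
  lunitVK : forall x y (f : hom x y), comp2 (lunit f) (lunitV f) = id2 f;
  runitK : forall x y (f : hom x y),
    comp2 (runitV f) (runit f) = id2 (comp1 f (id1 x));
  runitVK : forall x y (f : hom x y), comp2 (runit f) (runitV f) = id2 f;
  pentagon : forall v w x y z
    (k : hom y z) (h : hom x y) (g : hom w x) (f : hom v w),
    comp2 (assoc k h (comp1 g f)) (assoc (comp1 k h) g f)
    = comp2 (hcomp (id2 k) (assoc h g f))
        (comp2 (assoc k (comp1 h g) f) (hcomp (assoc k h g) (id2 f)));
  triangle : forall x y z (g : hom y z) (f : hom x y),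
    comp2 (hcomp (id2 g) (lunit f)) (assoc g (id1 y) f)
    = hcomp (runit g) (id2 f)
}.

Arguments hom {_} x y.
Arguments cell {_ x y} f g.
Arguments id1 {_} x.
Arguments comp1 {_ x y z} g f.
Arguments id2 {_ x y} f.
Arguments comp2 {_ x y f g h} _ _.
Arguments hcomp {_ x y z g g' f f'} _ _.
Arguments assoc {_ w x y z} h g f.
Arguments assocV {_ w x y z} h g f.
Arguments lunit {_ x y} f.
Arguments lunitV {_ x y} f.
Arguments runit {_ x y} f.
Arguments runitV {_ x y} f.

Notation "g \o1 f" := (comp1 g f) : bicat_scope.
Notation "b \o2 a" := (comp2 b a) : bicat_scope.
Notation "b \oh a" := (hcomp b a) : bicat_scope.
Notation "g '\lw' a" := (hcomp (id2 g) a) (at level 40, a at next level) : bicat_scope.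
Notation "b '\rw' f" := (hcomp b (id2 f)) (at level 40, f at next level) : bicat_scope.

Definition invertible (B : bicategory) (x y : B) (f g : hom x y)
    (a : cell f g) : Prop :=
  exists b : cell g f, b \o2 a = id2 f /\ a \o2 b = id2 g.

Record pseudofunctor (B C : bicategory) := Pseudofunctor {
  pobj :> B -> C;
  phom : forall x y : B, hom x y -> hom (pobj x) (pobj y);
  pcell : forall (x y : B) (f g : hom x y),
    cell f g -> cell (phom f) (phom g);
  pcompositor : forall (x y z : B) (g : hom y z) (f : hom x y),
    cell (phom g \o1 phom f) (phom (g \o1 f));
  punitor : forall x : B, cell (id1 (pobj x)) (phom (id1 x));
  pcompositor_inv : forall (x y z : B) (g : hom y z) (f : hom x y),
    invertible (pcompositor g f);
  punitor_inv : forall x : B, invertible (punitor x);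
  pcell1 : forall (x y : B) (f : hom x y), pcell (id2 f) = id2 (phom f);
  pcell2 : forall (x y : B) (f g h : hom x y) (b : cell g h) (a : cell f g),
    pcell (b \o2 a) = pcell b \o2 pcell a;
  pcompositor_nat : forall (x y z : B) (g g' : hom y z) (f f' : hom x y)
    (b : cell g g') (a : cell f f'),
    pcompositor g' f' \o2 (pcell b \oh pcell a)
    = pcell (b \oh a) \o2 pcompositor g f;
  pcompositor_assoc : forall (w x y z : B)
    (h : hom y z) (g : hom x y) (f : hom w x),
    pcompositor h (g \o1 f) \o2 (phom h \lw pcompositor g f)
      \o2 assoc (phom h) (phom g) (phom f)
    = pcell (assoc h g f) \o2 pcompositor (h \o1 g) f
      \o2 (pcompositor h g \rw phom f);
  plunit : forall (x y : B) (f : hom x y),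
    lunit (phom f)
    = pcell (lunit f) \o2 pcompositor (id1 y) f \o2 (punitor y \rw phom f);
  prunit : forall (x y : B) (f : hom x y),
    runit (phom f)
    = pcell (runit f) \o2 pcompositor f (id1 x) \o2 (phom f \lw punitor x)
}.

Arguments phom {B C} p {x y} _.
Arguments pcell {B C} p {x y f g} _.
Arguments pcompositor {B C} p {x y z} g f.
Arguments punitor {B C} p x.

Record strong_transformation (B C : bicategory) (F G : pseudofunctor B C) :=
  StrongTransformation {
  tcomp : forall x : B, hom (F x) (G x);
  tcell : forall (x y : B) (f : hom x y),
    cell (phom G f \o1 tcomp x) (tcomp y \o1 phom F f);
  tcell_inv : forall (x y : B) (f : hom x y), invertible (tcell f);
  tcell_nat : forall (x y : B) (f g : hom x y) (a : cell f g),
    tcell g \o2 (pcell G a \rw tcomp x) = (tcomp y \lw pcell F a) \o2 tcell f;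
  tcell_unit : forall x : B,
    tcell (id1 x) \o2 (punitor G x \rw tcomp x)
    = (tcomp x \lw punitor F x) \o2 runitV (tcomp x) \o2 lunit (tcomp x);
  tcell_comp : forall (x y z : B) (g : hom y z) (f : hom x y),
    tcell (g \o1 f) \o2 (pcompositor G g f \rw tcomp x)
    = (tcomp z \lw pcompositor F g f) \o2 assoc (tcomp z) (phom F g) (phom F f)
      \o2 (tcell g \rw phom F f) \o2 assocV (phom G g) (tcomp y) (phom F f)
      \o2 (phom G g \lw tcell f) \o2 assoc (phom G g) (phom G f) (tcomp x)
}.

Arguments tcomp {B C F G} s x.
Arguments tcell {B C F G} s {x y} f.

Section Coherence.
Variable B : bicategory.
Implicit Types w x y z : B.

Lemma lw2 x y z (k : hom y z) (f g h : hom x y) (b : cell g h) (a : cell f g) :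
  k \lw (b \o2 a) = (k \lw b) \o2 (k \lw a).
Proof. by rewrite -interchange comp21. Qed.

Lemma rw2 x y z (f g h : hom y z) (k : hom x y) (b : cell g h) (a : cell f g) :
  (b \o2 a) \rw k = (b \rw k) \o2 (a \rw k).
Proof. by rewrite -interchange comp21. Qed.

Lemma whiskerC x y z (g g' : hom y z) (f f' : hom x y)
    (b : cell g g') (a : cell f f') :
  (b \rw f') \o2 (g \lw a) = (g' \lw a) \o2 (b \rw f).
Proof. by rewrite -!interchange !comp21 !comp12. Qed.

Lemma comp2I x y (f g h : hom x y) (b : cell g h) (a a' : cell f g) :
  invertible b -> b \o2 a = b \o2 a' -> a = a'.
Proof.
by move=> [c [cb _]] /(congr1 (comp2 c)); rewrite !comp2A cb !comp12.
Qed.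

Lemma comp2Ir x y (f g h : hom x y) (b b' : cell g h) (a : cell f g) :
  invertible a -> b \o2 a = b' \o2 a -> b = b'.
Proof.
by move=> [c [_ ac]] /(congr1 (comp2^~ c)); rewrite -!comp2A ac !comp21.
Qed.

Lemma inv_comp2 x y (f g h : hom x y) (b : cell g h) (a : cell f g) :
  invertible b -> invertible a -> invertible (b \o2 a).
Proof.
move=> [b' [b1 b2]] [a' [a1 a2]]; exists (a' \o2 b'); split.
- by rewrite comp2A -(comp2A a') b1 comp21.
- by rewrite comp2A -(comp2A b) a2 comp21.
Qed.

Lemma inv_id2 x y (f : hom x y) : invertible (id2 f).
Proof. by exists (id2 f); rewrite comp21. Qed.

Lemma inv_hcomp x y z (g g' : hom y z) (f f' : hom x y)
    (b : cell g g') (a : cell f f') :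
  invertible b -> invertible a -> invertible (b \oh a).
Proof.
move=> [b' [b1 b2]] [a' [a1 a2]]; exists (b' \oh a'); split.
- by rewrite -interchange b1 a1 hcomp1.
- by rewrite -interchange b2 a2 hcomp1.
Qed.

Lemma inv_assoc w x y z (h : hom y z) (g : hom x y) (f : hom w x) :
  invertible (assoc h g f).
Proof. by exists (assocV h g f); rewrite assocK assocVK. Qed.

Lemma inv_assocV w x y z (h : hom y z) (g : hom x y) (f : hom w x) :
  invertible (assocV h g f).
Proof. by exists (assoc h g f); rewrite assocK assocVK. Qed.

Lemma inv_lunit x y (f : hom x y) : invertible (lunit f).
Proof. by exists (lunitV f); rewrite lunitK lunitVK. Qed.

Lemma inv_runit x y (f : hom x y) : invertible (runit f).
Proof. by exists (runitV f); rewrite runitK runitVK. Qed.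

Lemma assocV_nat w x y z (h h' : hom y z) (g g' : hom x y) (f f' : hom w x)
    (c : cell h h') (b : cell g g') (a : cell f f') :
  assocV h' g' f' \o2 (c \oh (b \oh a)) = ((c \oh b) \oh a) \o2 assocV h g f.
Proof.
apply: (comp2I (inv_assoc h' g' f')).
rewrite comp2A assocVK comp12 comp2A assoc_nat -comp2A assocVK comp21 //.
Qed.

Lemma id1_lw_inj x y (f g : hom x y) (a b : cell f g) :
  id1 y \lw a = id1 y \lw b -> a = b.
Proof.
move=> e; apply: (comp2Ir (inv_lunit f)).
by rewrite -!lunit_nat e.
Qed.

Lemma rw_id1_inj x y (f g : hom x y) (a b : cell f g) :
  a \rw id1 x = b \rw id1 x -> a = b.
Proof.
move=> e; apply: (comp2Ir (inv_runit f)).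
by rewrite -!runit_nat e.
Qed.

(* Kelly's two redundant unit axioms *)
Lemma lunit_comp1 x y z (g : hom y z) (f : hom x y) :
  lunit (g \o1 f) \o2 assoc (id1 z) g f = lunit g \rw f.
Proof.
apply: id1_lw_inj.
have i : invertible (assoc (id1 z) (id1 z \o1 g) f
                     \o2 (assoc (id1 z) (id1 z) g \rw f)).
  by apply: inv_comp2 (inv_assoc _ _ _) (inv_hcomp (inv_assoc _ _ _) (inv_id2 _)).
apply: (comp2Ir i).
rewrite lw2 -[LHS]comp2A -pentagon comp2A triangle.
rewrite -(hcomp1 g f) -assoc_nat -triangle rw2 comp2A assoc_nat.
by rewrite -!comp2A.
Qed.

Lemma runit_comp1 x y z (g : hom y z) (f : hom x y) :
  (g \lw runit f) \o2 assoc g f (id1 x) = runit (g \o1 f).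
Proof.
apply: rw_id1_inj.
apply: (comp2I (inv_assoc g f (id1 x))).
rewrite rw2 comp2A assoc_nat -triangle lw2 -!comp2A -pentagon.
by rewrite comp2A -assoc_nat hcomp1 -comp2A triangle.
Qed.

Lemma pentagonV v w x y z
    (k : hom y z) (h : hom x y) (g : hom w x) (f : hom v w) :
  (assocV k h g \rw f) \o2 assocV k (h \o1 g) f \o2 (k \lw assocV h g f)
  = assocV (k \o1 h) g f \o2 assocV k h (g \o1 f).
Proof.
apply: (comp2Ir (inv_assoc k h (g \o1 f))).
apply: (comp2Ir (inv_assoc (k \o1 h) g f)).
rewrite -(comp2A (assocV _ _ _)) assocK comp21 assocK -!comp2A pentagon.
rewrite (comp2A (k \lw assocV _ _ _)) -lw2 assocK hcomp1 comp12.
by rewrite (comp2A (assocV k _ f)) assocK comp12 -rw2 assocK hcomp1.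
Qed.

(* the 1-cells form a ladder Hf, Hg over Gf, Gg over Ff, Fg *)
Lemma pasting_lower v w x y z t (k : hom y z) (s : hom x y) (Fg : hom w x)
    (Ff : hom v w) (s' : hom w t) (Gg : hom t y) (u : B) (k' : hom t u)
    (Hg : hom u z) (b : cell (Gg \o1 s') (s \o1 Fg))
    (c : cell (Hg \o1 k') (k \o1 Gg)) :
  assocV k s (Fg \o1 Ff) \o2 (k \lw assoc s Fg Ff) \o2 (k \lw (b \rw Ff))
    \o2 (k \lw assocV Gg s' Ff) \o2 assoc k Gg (s' \o1 Ff)
    \o2 (c \rw (s' \o1 Ff))
  = assoc (k \o1 s) Fg Ff
    \o2 ((assocV k s Fg \o2 (k \lw b) \o2 assoc k Gg s' \o2 (c \rw s')) \rw Ff)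
    \o2 assocV (Hg \o1 k') s' Ff.
Proof.
apply: (comp2I (inv_assoc k s (Fg \o1 Ff))).
apply: (comp2Ir (inv_assoc (Hg \o1 k') s' Ff)).
rewrite !comp2A assocVK comp12 pentagon -(comp2A _ (assocV _ _ _)) assocK comp21.
rewrite !rw2 -!comp2A (comp2A (assoc k s Fg \rw _)) -rw2 assocVK hcomp1 comp12.
apply: (congr1 (comp2 _)); rewrite -hcomp1 -assoc_nat.
rewrite (comp2A (assoc k _ Ff)) (assoc_nat (id2 k) b (id2 Ff)) -!comp2A; apply: (congr1 (comp2 _)).
rewrite (comp2A (assoc k _ _)) pentagon -!comp2A.
by rewrite (comp2A (k \lw assocV _ _ _)) -lw2 assocK hcomp1 comp12.
Qed.

Lemma pasting_upper v w x y z t (Hg : hom y z) (Hf : hom x y) (k : hom w x)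
    (s : hom v w) (k' : hom t y) (Gf : hom w t) (u : B) (s' : hom u t)
    (Ff : hom v u) (b : cell (Hf \o1 k) (k' \o1 Gf))
    (a : cell (Gf \o1 s) (s' \o1 Ff)) :
  ((Hg \o1 k') \lw a) \o2 assoc (Hg \o1 k') Gf s
    \o2 (assocV Hg k' Gf \rw s) \o2 ((Hg \lw b) \rw s)
    \o2 (assoc Hg Hf k \rw s) \o2 assocV (Hg \o1 Hf) k s
  = assocV Hg k' (s' \o1 Ff)
    \o2 (Hg \lw ((k' \lw a) \o2 assoc k' Gf s \o2 (b \rw s) \o2 assocV Hf k s))
    \o2 assoc Hg Hf (k \o1 s).
Proof.
apply: (comp2I (inv_assoc Hg k' (s' \o1 Ff))).
apply: (comp2Ir (inv_assoc (Hg \o1 Hf) k s)).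
rewrite !comp2A assocVK comp12 -(comp2A _ (assocV _ _ _)) assocK comp21.
rewrite -(hcomp1 Hg) assoc_nat.
rewrite -[RHS]comp2A pentagon !lw2 -!comp2A.
rewrite (comp2A (Hg \lw assocV _ _ _)) -lw2 assocK hcomp1 comp12.
apply: (congr1 (comp2 _)).
rewrite (comp2A (assoc Hg _ _) (assoc _ _ _)) pentagon -!comp2A.
rewrite (comp2A (assoc _ _ _ \rw s)) -rw2 assocVK hcomp1 comp12.
apply: (congr1 (comp2 _)).
by rewrite !comp2A assoc_nat.
Qed.

End Coherence.

Section Composite.
Variables (B C : bicategory) (F G H : pseudofunctor B C).
Variables (t : strong_transformation G H) (s : strong_transformation F G).

(* The component at f is the pasting of the squares of s and t:
   (H f) (t s) -> (H f t) s -> (t (G f)) s -> t (G f s) -> t (s F f) -> (t s) F f. *)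
Definition comp_tcomp (x : B) : hom (F x) (H x) := tcomp t x \o1 tcomp s x.

Definition comp_tcell (x y : B) (f : hom x y) :
    cell (phom H f \o1 comp_tcomp x) (comp_tcomp y \o1 phom F f) :=
  assocV (tcomp t y) (tcomp s y) (phom F f)
  \o2 (tcomp t y \lw tcell s f)
  \o2 assoc (tcomp t y) (phom G f) (tcomp s x)
  \o2 (tcell t f \rw tcomp s x)
  \o2 assocV (phom H f) (tcomp t x) (tcomp s x).

Lemma comp_tcell_inv x y (f : hom x y) : invertible (comp_tcell f).
Proof.
by rewrite /comp_tcell; repeat apply: inv_comp2;
  solve [apply: inv_assocV | apply: inv_assoc
        | apply: inv_hcomp; solve [apply: inv_id2 | apply: tcell_inv]].
Qed.

Lemma comp_tcell_nat x y (f g : hom x y) (a : cell f g) :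
  comp_tcell g \o2 (pcell H a \rw comp_tcomp x)
  = (comp_tcomp y \lw pcell F a) \o2 comp_tcell f.
Proof.
rewrite /comp_tcell /comp_tcomp -(hcomp1 (tcomp t x)) -[LHS]comp2A assocV_nat.
rewrite -!(comp2A _ (tcell t g \rw _)) (comp2A (tcell t g \rw _)) -rw2.
rewrite tcell_nat rw2 !comp2A.
rewrite -(comp2A _ (assoc _ _ _) ((_ \lw _) \rw _)) assoc_nat.
rewrite !comp2A -(comp2A _ (_ \lw tcell s g)) -lw2 tcell_nat lw2 !comp2A.
by rewrite assocV_nat hcomp1.
Qed.

Lemma comp_tcell_unit x :
  comp_tcell (id1 x) \o2 (punitor H x \rw comp_tcomp x)
  = (comp_tcomp x \lw punitor F x) \o2 runitV (comp_tcomp x)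
    \o2 lunit (comp_tcomp x).
Proof.
rewrite /comp_tcell /comp_tcomp -(hcomp1 (tcomp t x)) -[LHS]comp2A assocV_nat.
rewrite -!(comp2A _ (tcell t _ \rw _)) (comp2A (tcell t _ \rw _)) -rw2.
rewrite tcell_unit !rw2 !comp2A.
rewrite -(comp2A _ (assoc _ _ _) ((_ \lw _) \rw _)) assoc_nat.
rewrite !comp2A -(comp2A _ (_ \lw tcell s _)) -lw2 tcell_unit !lw2 !comp2A.
rewrite assocV_nat hcomp1.
rewrite -(comp2A _ (_ \lw lunit _)) triangle.
rewrite -(comp2A _ (runit _ \rw _)) -rw2 runitVK hcomp1 comp21.
rewrite -lunit_comp1 -!comp2A assocVK comp21; apply: (congr1 (comp2 _)).
rewrite !comp2A; congr (_ \o2 _).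
apply: (comp2I (inv_runit _)); rewrite runitVK -runit_comp1.
rewrite comp2A -(comp2A (_ \lw _)) assocVK comp21 -lw2 runitVK hcomp1 //.
Qed.

Lemma comp_tcell_comp x y z (g : hom y z) (f : hom x y) :
  comp_tcell (g \o1 f) \o2 (pcompositor H g f \rw comp_tcomp x)
  = (comp_tcomp z \lw pcompositor F g f)
    \o2 assoc (comp_tcomp z) (phom F g) (phom F f)
    \o2 (comp_tcell g \rw phom F f)
    \o2 assocV (phom H g) (comp_tcomp y) (phom F f)
    \o2 (phom H g \lw comp_tcell f)
    \o2 assoc (phom H g) (phom H f) (comp_tcomp x).
Proof.
rewrite {1}/comp_tcell /comp_tcomp -(hcomp1 (tcomp t x)) -[LHS]comp2A assocV_nat.
rewrite -!(comp2A _ (tcell t _ \rw _)) (comp2A (tcell t _ \rw _)) -rw2.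
rewrite tcell_comp.
rewrite -!(comp2A (tcomp t z \lw _)) rw2 !comp2A.
rewrite -(comp2A _ (assoc _ _ _) ((_ \lw _) \rw _)) assoc_nat.
rewrite !comp2A -(comp2A _ (_ \lw tcell s _)) -lw2 tcell_comp.
rewrite -!(comp2A (tcomp s z \lw _)) lw2 !comp2A.
rewrite assocV_nat hcomp1 -!comp2A; apply: (congr1 (comp2 _)).
rewrite !comp2A.
transitivity (assoc (tcomp t z \o1 tcomp s z) (phom F g) (phom F f)
  \o2 ((assocV (tcomp t z) (tcomp s z) (phom F g) \o2 (tcomp t z \lw tcell s g)
        \o2 assoc (tcomp t z) (phom G g) (tcomp s y) \o2 (tcell t g \rw tcomp s y))
       \rw phom F f)
  \o2 assocV (phom H g \o1 tcomp t y) (tcomp s y) (phom F f)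
  \o2 (assocV (phom H g) (tcomp t y) (tcomp s y \o1 phom F f)
    \o2 (phom H g \lw ((tcomp t y \lw tcell s f)
         \o2 assoc (tcomp t y) (phom G f) (tcomp s x) \o2 (tcell t f \rw tcomp s x)
         \o2 assocV (phom H f) (tcomp t x) (tcomp s x)))
    \o2 assoc (phom H g) (phom H f) (tcomp t x \o1 tcomp s x))).
  rewrite -pasting_lower -pasting_upper !rw2 !lw2.
  rewrite -!comp2A; do 4 apply: (congr1 (comp2 _)).
  rewrite (comp2A (tcell t g \rw (tcomp s y \o1 phom F f))) whiskerC -!comp2A.
  rewrite (comp2A (assoc (tcomp t z) (phom G g) _)) -(hcomp1 (tcomp t z)).
  rewrite assoc_nat -!comp2A; apply: (congr1 (comp2 _)).
  rewrite (comp2A (tcell t g \rw _)) -(hcomp1 (phom G f)) -assoc_nat.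
  rewrite -!comp2A (comp2A (assoc (tcomp t z) _ _) (assoc _ _ _)) pentagon.
  by rewrite -!comp2A.
rewrite /comp_tcell (rw2 _ (_ \o2 _) (assocV _ _ _)) -!(comp2A (assocV _ _ _)).
rewrite (lw2 _ (assocV _ _ _)) -!comp2A.
rewrite (comp2A (assocV _ _ _ \rw phom F f)) (comp2A (assocV _ _ _ \rw phom F f \o2 _)).
by rewrite pentagonV -!comp2A.
Qed.
End Composite.

Definition comp_transformation (B C : bicategory) (F G H : pseudofunctor B C)
    (t : strong_transformation G H) (s : strong_transformation F G) :
    strong_transformation F H :=
  StrongTransformation (comp_tcell_inv t s) (comp_tcell_nat t s)
    (comp_tcell_unit t s) (comp_tcell_comp t s).

Record monoidal_category := MonoidalCategory {
  mobj :> Type;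
  mmor : mobj -> mobj -> Type;
  mid : forall a, mmor a a;
  mcomp : forall a b c, mmor b c -> mmor a b -> mmor a c;
  munit : mobj;
  mtens : mobj -> mobj -> mobj;
  mtensm : forall a a' b b',
    mmor a a' -> mmor b b' -> mmor (mtens a b) (mtens a' b');
  massoc : forall a b c, mmor (mtens (mtens a b) c) (mtens a (mtens b c));
  massocV : forall a b c, mmor (mtens a (mtens b c)) (mtens (mtens a b) c);
  mlunit : forall a, mmor (mtens munit a) a;
  mlunitV : forall a, mmor a (mtens munit a);
  mrunit : forall a, mmor (mtens a munit) a;
  mrunitV : forall a, mmor a (mtens a munit);
  mcompA : forall a b c d (r : mmor c d) (q : mmor b c) (p : mmor a b),
    mcomp r (mcomp q p) = mcomp (mcomp r q) p;
  mcomp1r : forall a b (p : mmor a b), mcomp p (mid a) = p;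
  mcomp1l : forall a b (p : mmor a b), mcomp (mid b) p = p;
  mtensm1 : forall a b, mtensm (mid a) (mid b) = mid (mtens a b);
  mtensm_comp : forall a a' a'' b b' b'' (q' : mmor a' a'') (q : mmor a a')
    (p' : mmor b' b'') (p : mmor b b'),
    mtensm (mcomp q' q) (mcomp p' p) = mcomp (mtensm q' p') (mtensm q p);
  massoc_nat : forall a a' b b' c c' (r : mmor a a') (q : mmor b b')
    (p : mmor c c'),
    mcomp (massoc a' b' c') (mtensm (mtensm r q) p)
    = mcomp (mtensm r (mtensm q p)) (massoc a b c);
  mlunit_nat : forall a b (p : mmor a b),
    mcomp (mlunit b) (mtensm (mid munit) p) = mcomp p (mlunit a);
  mrunit_nat : forall a b (p : mmor a b),
    mcomp (mrunit b) (mtensm p (mid munit)) = mcomp p (mrunit a);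
  massocK : forall a b c,
    mcomp (massocV a b c) (massoc a b c) = mid (mtens (mtens a b) c);
  massocVK : forall a b c,
    mcomp (massoc a b c) (massocV a b c) = mid (mtens a (mtens b c));
  mlunitK : forall a, mcomp (mlunitV a) (mlunit a) = mid (mtens munit a);
  mlunitVK : forall a, mcomp (mlunit a) (mlunitV a) = mid a;
  mrunitK : forall a, mcomp (mrunitV a) (mrunit a) = mid (mtens a munit);
  mrunitVK : forall a, mcomp (mrunit a) (mrunitV a) = mid a;
  mpentagon : forall a b c d,
    mcomp (massoc a b (mtens c d)) (massoc (mtens a b) c d)
    = mcomp (mtensm (mid a) (massoc b c d))
        (mcomp (massoc a (mtens b c) d) (mtensm (massoc a b c) (mid d)));
  mtriangle : forall a b,
    mcomp (mtensm (mid a) (mlunit b)) (massoc a munit b)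
    = mtensm (mrunit a) (mid b)
}.

Arguments mmor {m} a b.
Arguments mid {m} a.
Arguments mcomp {m a b c} _ _.
Arguments munit {m}.
Arguments mtens {m} a b.

Definition is_2group (M : monoidal_category) : Prop :=
  (forall (a b : M) (p : mmor a b),
     exists q : mmor b a, mcomp q p = mid a /\ mcomp p q = mid b)
  /\ (forall a : M, exists b : M,
        inhabited (mmor (mtens a b) munit) /\ inhabited (mmor (mtens b a) munit)).

Definition deloop (M : monoidal_category) : bicategory :=
  @Bicategory unit (fun _ _ => M) (fun _ _ => @mmor M) (fun _ => munit)
    (fun _ _ _ => mtens) (fun _ _ => mid) (fun _ _ => @mcomp M)
    (fun _ _ _ => @mtensm M) (fun _ _ _ _ => @massoc M)
    (fun _ _ _ _ => @massocV M) (fun _ _ => @mlunit M) (fun _ _ => @mlunitV M)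
    (fun _ _ => @mrunit M) (fun _ _ => @mrunitV M) (fun _ _ => @mcompA M)
    (fun _ _ => @mcomp1r M) (fun _ _ => @mcomp1l M) (fun _ _ _ => @mtensm1 M)
    (fun _ _ _ => @mtensm_comp M) (fun _ _ _ _ => @massoc_nat M)
    (fun _ _ => @mlunit_nat M) (fun _ _ => @mrunit_nat M)
    (fun _ _ _ _ => @massocK M) (fun _ _ _ _ => @massocVK M)
    (fun _ _ => @mlunitK M) (fun _ _ => @mlunitVK M)
    (fun _ _ => @mrunitK M) (fun _ _ => @mrunitVK M)
    (fun _ _ _ _ _ => @mpentagon M) (fun _ _ _ => @mtriangle M).

Local Open Scope ring_scope.

(* Z as a discrete monoidal category: a morphism is an equality of integers. *)
Definition int_monoidal : monoidal_category.
Proof.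
refine (@MonoidalCategory int (fun m n => m = n) (fun m => erefl)
  (fun _ _ _ q p => etrans p q) 0 +%R
  (fun _ _ _ _ q p => f_equal2 +%R q p)
  (fun a b c => esym (addrA a b c)) (fun a b c => addrA a b c)
  (fun a => add0r a) (fun a => esym (add0r a)) (fun a => addr0 a) (fun a => esym (addr0 a))
  _ _ _ _ _ _ _ _ _ _ _ _ _ _ _ _); move=> *; exact: eq_irrelevance.
Defined.

Definition BZ : bicategory := deloop int_monoidal.

(* The unit circle, written additively: + is multiplication of complex
   numbers. *)
Record U1 (R : realType) := MkU1 { u1val :> R[i]; _ : `|u1val| == 1 }.

HB.instance Definition _ (R : realType) := [isSub for @u1val R].
HB.instance Definition _ (R : realType) := [Choice of U1 R by <:].

Section CircleGroup.
Variable R : realType.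
Implicit Types z w : U1 R.

Lemma U1_norm z : `|u1val z| = 1.
Proof. by case: z => z /= /eqP. Qed.

Lemma U1_neq0 z : u1val z != 0.
Proof. by rewrite -normr_eq0 U1_norm oner_eq0. Qed.

Fact U1_zero_proof : `|1 : R[i]| == 1.
Proof. by rewrite normr1. Qed.
Fact U1_opp_proof z : `|(u1val z)^-1| == 1.
Proof. by rewrite normfV U1_norm invr1. Qed.
Fact U1_add_proof z w : `|u1val z * u1val w| == 1.
Proof. by rewrite normrM !U1_norm mulr1. Qed.

Definition U1_zero : U1 R := MkU1 U1_zero_proof.
Definition U1_opp z : U1 R := MkU1 (U1_opp_proof z).
Definition U1_add z w : U1 R := MkU1 (U1_add_proof z w).

Fact U1_addA : associative U1_add.
Proof. by move=> x y z; apply: val_inj; rewrite /= mulrA. Qed.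
Fact U1_addC : commutative U1_add.
Proof. by move=> x y; apply: val_inj; rewrite /= mulrC. Qed.
Fact U1_add0 : left_id U1_zero U1_add.
Proof. by move=> x; apply: val_inj; rewrite /= mul1r. Qed.
Fact U1_addN : left_inverse U1_zero U1_opp U1_add.
Proof. by move=> x; apply: val_inj; rewrite /= mulVf ?U1_neq0. Qed.
End CircleGroup.

HB.instance Definition _ (R : realType) :=
  GRing.isZmodule.Build (U1 R)
    (@U1_addA R) (@U1_addC R) (@U1_add0 R) (@U1_addN R).

Record Z3 (G : finGroupType) (A : zmodType) := MkZ3 {
  z3fun :> G -> G -> G -> A;
  z3P : forall g1 g2 g3 g4 : G,
    z3fun g2 g3 g4 - z3fun (g1 * g2)%g g3 g4 + z3fun g1 (g2 * g3)%g g4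
    - z3fun g1 g2 (g3 * g4)%g + z3fun g1 g2 g3 = 0
}.

Section CocycleFacts.
Variables (G : finGroupType) (A : zmodType) (al : Z3 G A).
Implicit Types f g h k : G.

Lemma z3_pentagon f g h k :
  al f g (h * k)%g + al (f * g)%g h k
  = al g h k + (al f (g * h)%g k + al f g h).
Proof.
rewrite -[LHS]add0r -(z3P al f g h k) (AC (5*2) ((1*(3*5))*((2*7)*(4*6)))).
by rewrite /= !addNr !addr0.
Qed.

Lemma z3_mid1 f h : al f 1%g h = al 1%g 1%g h + al f 1%g 1%g.
Proof.
apply: (addrI (al f 1%g h)).
by have := z3_pentagon f 1%g 1%g h; rewrite !mul1g !mulg1 addrCA.
Qed.
End CocycleFacts.

Section TwoGroup.
Variables (G : finGroupType) (A : zmodType).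
Implicit Types a b c d : G.

Definition gmor a b := {p : G * A | (p.1 == a) && (p.1 == b)}.

Definition phase a b (p : gmor a b) : A := (val p).2.

Lemma gmor_src a b (p : gmor a b) : (val p).1 = a.
Proof. by case: p => /= p /andP[/eqP]. Qed.

Lemma gmor_tgt a b (p : gmor a b) : (val p).1 = b.
Proof. by case: p => /= p /andP[_ /eqP]. Qed.

Lemma phase_inj a b : injective (@phase a b).
Proof.
move=> p q e; apply: val_inj.
have e1 : (val p).1 = (val q).1 by rewrite !gmor_src.
by rewrite [LHS]surjective_pairing [RHS]surjective_pairing e1; congr pair.
Qed.

Definition gmor_of a b (e : a = b) (u : A) : gmor a b :=
  exist _ (a, u) (introT andP (conj (eqxx a) (introT eqP e))).

Fact gmor_comp_proof a b c (q : gmor b c) (p : gmor a b) :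
  ((val p).1 == a) && ((val p).1 == c).
Proof. by rewrite gmor_src eqxx -(gmor_src p) gmor_tgt -(gmor_src q) gmor_tgt /=. Qed.

Definition gmor_comp a b c (q : gmor b c) (p : gmor a b) : gmor a c :=
  exist _ ((val p).1, phase q + phase p) (gmor_comp_proof q p).

Fact gmor_tens_proof a a' b b' (q : gmor a a') (p : gmor b b') :
  (((val q).1 * (val p).1)%g == (a * b)%g)
  && (((val q).1 * (val p).1)%g == (a' * b')%g).
Proof. by rewrite {1}(gmor_src q) {1}(gmor_src p) (gmor_tgt q) (gmor_tgt p) !eqxx. Qed.

Definition gmor_tens a a' b b' (q : gmor a a') (p : gmor b b') :
    gmor (a * b)%g (a' * b')%g :=
  exist _ (((val q).1 * (val p).1)%g, phase q + phase p) (gmor_tens_proof q p).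

Lemma gmor_eq a b (p : gmor a b) : b = a.
Proof. by rewrite -(gmor_tgt p) gmor_src. Qed.

Lemma phase_of a b (e : a = b) u : phase (gmor_of e u) = u.
Proof. by []. Qed.

Lemma phase_comp a b c (q : gmor b c) (p : gmor a b) :
  phase (gmor_comp q p) = phase q + phase p.
Proof. by []. Qed.

Lemma phase_tens a a' b b' (q : gmor a a') (p : gmor b b') :
  phase (gmor_tens q p) = phase q + phase p.
Proof. by []. Qed.

(* The triangle identity reads  mlunit b + al a 1 b = mrunit a,  and
   al a 1 b = al 1 1 b + al a 1 1  for every cocycle, so it determines the
   unitors up to one common constant; it is fixed by the unitors at the unit
   object being identities. *)
Definition Gamma (al : Z3 G A) : monoidal_category.
Proof.
refine (@MonoidalCategory G gmor (fun a => gmor_of erefl 0) gmor_comp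
  1%g (fun a b => (a * b)%g) gmor_tens
  (fun a b c => gmor_of (esym (mulgA a b c)) (al a b c))
  (fun a b c => gmor_of (mulgA a b c) (- al a b c))
  (fun a => gmor_of (mul1g a) (- al 1%g 1%g a))
  (fun a => gmor_of (esym (mul1g a)) (al 1%g 1%g a))
  (fun a => gmor_of (mulg1 a) (al a 1%g 1%g))
  (fun a => gmor_of (esym (mulg1 a)) (- al a 1%g 1%g))
  _ _ _ _ _ _ _ _ _ _ _ _ _ _ _ _);
  intros; apply: phase_inj;
  rewrite ?(phase_comp, phase_tens, phase_of) ?(addr0, add0r) ?addrA
    ?(subrr, addNr) //.
- by rewrite -!addrA; congr (_ + _); rewrite addrCA.
- have -> : al a' b' c' = al a b c.
    by rewrite (gmor_eq r) (gmor_eq q) (gmor_eq p).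
  by rewrite -!addrA addrC -!addrA.
- have -> : al 1%g 1%g b = al 1%g 1%g a by rewrite (gmor_eq p).
  exact: addrC.
- have -> : al b 1%g 1%g = al a 1%g 1%g by rewrite (gmor_eq p).
  exact: addrC.
- by rewrite z3_pentagon addrA.
- by rewrite (z3_mid1 al a b) addKr.
Defined.

Lemma Gamma_2group (al : Z3 G A) : is_2group (Gamma al).
Proof.
split=> [a b p | a].
  exists (gmor_of (gmor_eq p) (- phase p)).
  by split; apply: phase_inj; rewrite phase_comp phase_of ?addNr ?subrr.
by exists a^-1%g; split; constructor; [exact: gmor_of (mulgV a) 0 | exact: gmor_of (mulVg a) 0].
Qed.
End TwoGroup.

Record groupoid := Groupoid {
  gobj :> Type;
  ghom : gobj -> gobj -> Type;
  gid : forall x, ghom x x;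
  gcomp : forall x y z, ghom y z -> ghom x y -> ghom x z;
  ginv : forall x y, ghom x y -> ghom y x;
  gcompA : forall w x y z (h : ghom y z) (g : ghom x y) (f : ghom w x),
    gcomp h (gcomp g f) = gcomp (gcomp h g) f;
  gcomp1 : forall x y (f : ghom x y), gcomp f (gid x) = f;
  gcomp1l : forall x y (f : ghom x y), gcomp (gid y) f = f;
  gcompV : forall x y (f : ghom x y), gcomp (ginv f) f = gid x;
  gcompVr : forall x y (f : ghom x y), gcomp f (ginv f) = gid y
}.

Arguments ghom {_} x y.
Arguments gcomp {_ x y z} _ _.

Record Z2 (X : groupoid) (A : zmodType) := MkZ2 {
  z2fun :> forall x y z : X, ghom y z -> ghom x y -> A;
  z2P : forall (w x y z : X) (k : ghom y z) (h : ghom x y) (g : ghom w x),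
    z2fun h g - z2fun (gcomp k h) g + z2fun k (gcomp h g) - z2fun k h = 0
}.

Section Inertia.
Variable G : finGroupType.
Implicit Types x y z g h : G.

Definition inertia_hom x y := {h : G | (h * x * h^-1)%g == y}.

Lemma inertia_homP x y (h : inertia_hom x y) : (val h * x * (val h)^-1)%g = y.
Proof. exact/eqP/(valP h). Qed.

Fact inertia_id_proof x : (1 * x * 1^-1)%g == x.
Proof. by rewrite mul1g invg1 mulg1. Qed.

Fact inertia_comp_proof x y z (k : inertia_hom y z) (h : inertia_hom x y) :
  (val k * val h * x * (val k * val h)^-1)%g == z.
Proof.
by rewrite invMg !mulgA -(mulgA _ _ x) -(mulgA _ (_ * x)%g) inertia_homP
           inertia_homP.
Qed.

Fact inertia_inv_proof x y (h : inertia_hom x y) :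
  ((val h)^-1 * y * (val h)^-1^-1)%g == x.
Proof.
have := inertia_homP h; move: (val h) => k <-.
by rewrite invgK !mulgA mulVg mul1g mulgKV.
Qed.

Definition inertia : groupoid.
Proof.
refine (@Groupoid G inertia_hom (fun x => exist _ 1%g (inertia_id_proof x))
  (fun x y z (k : inertia_hom y z) (h : inertia_hom x y) =>
     exist _ (val k * val h)%g (inertia_comp_proof k h))
  (fun x y (h : inertia_hom x y) => exist _ (val h)^-1%g (inertia_inv_proof h)) _ _ _ _ _) => *;
  apply: val_inj.
- exact: mulgA.
- exact: mulg1.
- exact: mul1g.
- exact: mulVg.
- exact: mulgV.
Defined.

Definition inertia_arrow h g : @ghom inertia g (h * g * h^-1)%g :=
  exist _ h (eqxx _).
End Inertia.

(* the value on the composable pair [h'|h]g *)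
Definition at_pair (G : finGroupType) (A : zmodType) (c : Z2 (inertia G) A)
    (h' h g : G) : A :=
  c _ _ _ (inertia_arrow h' (h * g * h^-1)%g) (inertia_arrow h g).

Section Transgression.
Variables (G : finGroupType) (A : zmodType) (al : Z3 G A).

Definition transgression_fun (h' h g : G) : A :=
  al h' h g - al h' (h * g * h^-1)%g h
  + al (h' * h * g * (h' * h)^-1)%g h' h.

Lemma transgression_conj (h' h g y z : G) : (h * g * h^-1 = y)%g ->
  (h' * y * h'^-1 = z)%g ->
  transgression_fun h' h g = al h' h g - al h' y h + al z h' h.
Proof. by move=> <- <-; rewrite /transgression_fun invMg !mulgA. Qed.

Lemma transgression_closed (k h' h x y z w : G) :
  (h * x * h^-1 = y)%g -> (h' * y * h'^-1 = z)%g -> (k * z * k^-1 = w)%g ->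
  transgression_fun h' h x - transgression_fun (k * h')%g h x
  + transgression_fun k (h' * h)%g x - transgression_fun k h' y = 0.
Proof.
move=> ey ez ew.
have ez' : (h' * h * x * (h' * h)^-1)%g = z.
  by rewrite invMg !mulgA -(mulgA _ h) -(mulgA h') ?mulgA -ez -ey !mulgA.
have ew' : (k * h' * y * (k * h')^-1)%g = w by rewrite invMg -ew -ez !mulgA.
rewrite (transgression_conj ey ez) (transgression_conj ey ew').
rewrite (transgression_conj ez' ew) (transgression_conj ez ew).
have p1 := z3_pentagon al k h' h x.
have p2 := z3_pentagon al k h' y h.
have p3 := z3_pentagon al k z h' h.
have p4 := z3_pentagon al w k h' h.
have e1 : (h * x = y * h)%g by rewrite -ey mulgKV.
have e2 : (h' * y = z * h')%g by rewrite -ez mulgKV.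
have e3 : (k * z = w * k)%g by rewrite -ew mulgKV.
rewrite e1 in p1; rewrite e2 in p2; rewrite e3 in p3.
rewrite !opprD !opprK !addrA.
rewrite [LHS](ACl (1*3*5*7*9*11*(2*4*6*8*10*12))) /= -!opprD.
apply/eqP; rewrite subr_eq0; apply/eqP.
apply: (addIr (al k h' (y * h)%g + al k h' h + al k (z * h')%g h
               + al (w * k)%g h' h)).
rewrite [LHS](AC (6*4) ((1*(4*8))*(7*3)*(2*(9*6))*(5*10))) /= -p1 p2 -p3 p4.
by rewrite [RHS](AC (6*4) ((7*2)*(1*(9*5))*(4*10)*(8*(3*6)))).
Qed.

Definition transgression : Z2 (inertia G) A :=
  @MkZ2 (inertia G) A (fun x y z k h => transgression_fun (val k) (val h) x)
    (fun w x y z k h g => transgression_closed (inertia_homP g)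
       (inertia_homP h) (inertia_homP k)).
End Transgression.

Definition gexpz (G : finGroupType) (g : G) (n : int) : G :=
  match n with Posz k => (g ^+ k)%g | Negz k => (g ^- k.+1)%g end.

Lemma at_pair_transgression (G : finGroupType) (A : zmodType) (al : Z3 G A)
    (h' h g : G) :
  at_pair (transgression al) h' h g
  = al h' h g - al h' (h * g * h^-1)%g h
    + al (h' * h * g * (h' * h)^-1)%g h' h.
Proof. by []. Qed.

(* A pseudofunctor out of BZ sends the 1-cell n to loop F to the power n. *)
Definition loop (G : finGroupType) (A : zmodType) (al : Z3 G A)
    (F : pseudofunctor BZ (deloop (Gamma al))) : G :=
  @phom _ _ F tt tt (1 : int).

Definition component_1cell (G : finGroupType) (A : zmodType) (al : Z3 G A)
    (F F' : pseudofunctor BZ (deloop (Gamma al)))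
    (s : strong_transformation F F') : G := @tcomp _ _ _ _ s tt.

Definition component_2cell (G : finGroupType) (A : zmodType) (al : Z3 G A)
    (F F' : pseudofunctor BZ (deloop (Gamma al)))
    (s : strong_transformation F F') (n : int) : A :=
  phase (@tcell _ _ _ _ s tt tt n).

(* Main.v *)
(* The phase of the composite 2-cell is the sum of the phases of the two 2-cells
   and of the three associators of the pasting diagram, which are the three
   terms of the transgression at the object g^n.

   Conversely the formula pins down the transgression because every composable
   pair of arrows [h'|h]x is realised, already at n = 1.  The pullback of alpha
   along n |-> x^n is trivialised by an explicit cochain, since H^3(Z; A) = 0;
   this gives a pseudofunctor with loop x.  A pseudofunctor is then transported
   along any h in G so that the family of identity phases becomes a strong
   transformation with component h. *)
Require Import Defs.
From mathcomp Require Import all_boot all_order all_algebra all_fingroup.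
From mathcomp Require Import reals complex.

Set Implicit Arguments.
Unset Strict Implicit.
Unset Printing Implicit Defensive.

Import GRing.Theory Num.Theory.
Local Open Scope ring_scope.

(** * Integer powers and the phase of a composite *)

Section TransgressionFormula.
Variables (G : finGroupType) (A : zmodType) (al : Z3 G A).

(** With an equivalence as the step, cancellation in a group carries the induction to negative
    integers. *)
Lemma int_step_ind (P : int -> Prop) :
  P 0 -> (forall m, P m <-> P (1 + m)) -> forall m, P m.
Proof.
move=> P0 PS; elim=> [// | n Pn | n Pn].
  exact: (proj1 (PS n)) Pn.
by apply: (proj2 (PS _)); rewrite -add1n PoszD opprD addNKr.
Qed.

Lemma one_add_Negz n : 1 + Negz n.+1 = Negz n.
Proof. by rewrite !NegzE -(addn1 n.+1) PoszD opprD addrCA subrr addr0. Qed.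

Lemma gexpz1D (g : G) m : gexpz g (1 + m) = (g * gexpz g m)%g.
Proof.
case: m => [n | [|n]].
- by rewrite -PoszD add1n /= expgS.
- by rewrite /= expg1 mulgV.
- by rewrite one_add_Negz /= (expgSr _ n.+1) invMg mulKVg.
Qed.

Lemma gexpzD (g : G) m n : gexpz g (m + n) = (gexpz g m * gexpz g n)%g.
Proof.
elim/int_step_ind: m => [|m]; first by rewrite add0r mul1g.
rewrite -addrA !gexpz1D -mulgA; split=> [-> // | ]; exact: mulgI.
Qed.

(** Morphisms of [Gamma al] join only equal objects, so the unitor and the compositors give
    equations in [G]. *)
Lemma phom_gexpz (F : pseudofunctor BZ (deloop (Gamma al))) (n : int) :
  @phom _ _ F tt tt n = gexpz (loop F) n.
Proof.
elim/int_step_ind: n => [|n]; first exact: gmor_eq (@punitor _ _ F tt).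
have /gmor_eq := @pcompositor _ _ F tt tt tt (1 : int) n.
rewrite gexpz1D => /= ->; split=> [-> // | ]; exact: mulgI.
Qed.

Lemma comp_transformation_2cell (F F' F'' : pseudofunctor BZ (deloop (Gamma al)))
    (s : strong_transformation F F') (t : strong_transformation F' F'') n :
  component_2cell (comp_transformation t s) n
  = (component_2cell t n + component_2cell s n)
    - at_pair (transgression al)
        (component_1cell t) (component_1cell s) (gexpz (loop F) n).
Proof.
rewrite /component_1cell /component_2cell -phom_gexpz.
set h' := tcomp t tt; set h := tcomp s tt; set g := phom F _.
set g' := @phom _ _ F' tt tt n; set g'' := @phom _ _ F'' tt tt n.
have e1 : (h * g * h^-1 = g')%g.
  have -> : (h * g = g' * h)%g := gmor_eq (@tcell _ _ _ _ s tt tt n).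
  exact: mulgK.
have e2 : (h' * g' * h'^-1 = g'')%g.
  have -> : (h' * g' = g'' * h')%g := gmor_eq (@tcell _ _ _ _ t tt tt n).
  exact: mulgK.
rewrite [at_pair _ _ _ _](transgression_conj al e1 e2).
rewrite /= /comp_tcell !phase_comp !phase_tens /= !phase_of.
rewrite -/h -/h' -/g -/g' -/g''.
by rewrite add0r addr0 !opprD opprK !addrA [LHS](ACl (4*2*1*3*5)).
Qed.

(** * Pseudofunctors with trivial 2-cell part *)

Lemma z3_111 : al 1%g 1%g 1%g = 0.
Proof.
by have := z3_mid1 al 1%g 1%g; rewrite -[LHS]addr0 => /addrI.
Qed.

Lemma z3_left1 a b : al 1%g 1%g (a * b)%g = al 1%g a b + al 1%g 1%g a.
Proof.
have := z3_pentagon al 1%g 1%g a b.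
by rewrite !mul1g [LHS]addrC => /addrI.
Qed.

(* The phases of a pseudofunctor out of BZ whose 2-cell part is trivial; the
   right unit axiom is omitted because it follows from the others. *)
Record loop_data := LoopData {
  ld_power :> int -> G;
  ld_comp : int -> int -> A;
  ld_unit : A;
  ld_power0 : ld_power 0 = 1%g;
  ld_powerD : forall m n, ld_power (m + n) = (ld_power m * ld_power n)%g;
  ld_assoc : forall l m n,
    ld_comp l (m + n) + ld_comp m n + al (ld_power l) (ld_power m) (ld_power n)
    = ld_comp (l + m) n + ld_comp l m;
  ld_lunit : forall n, - al 1%g 1%g (ld_power n) = ld_comp 0 n + ld_unit
}.

(** Associativity at [n, 0, 0] reduces this to the left unit axiom at [0]. *)
Lemma ld_runit (D : loop_data) n : al (D n) 1%g 1%g = ld_comp D n 0 + ld_unit D.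
Proof.
have := ld_assoc D n 0 0; rewrite !addr0 -addrA => /addrI.
rewrite ld_power0 => <-; have := ld_lunit D 0; rewrite ld_power0 z3_111 oppr0.
by rewrite addrAC => <-; rewrite add0r.
Qed.

Lemma deloop_Gamma_inv x y (f g : @Defs.hom (deloop (Gamma al)) x y)
  (p : cell f g) : invertible p.
Proof. exact: (Gamma_2group al).1. Qed.

Definition loop_pseudofunctor (D : loop_data) :
  pseudofunctor BZ (deloop (Gamma al)).
Proof.
refine (@Pseudofunctor BZ (deloop (Gamma al)) (fun=> tt) (fun _ _ => ld_power D)
  (fun _ _ m n p => gmor_of (congr1 (ld_power D) p) 0)
  (fun _ _ _ m n => gmor_of (esym (ld_powerD D m n)) (ld_comp D m n))
  (fun _ => gmor_of (esym (ld_power0 D)) (ld_unit D))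
  (fun _ _ _ _ _ => deloop_Gamma_inv _) (fun _ => deloop_Gamma_inv _)
  _ _ _ _ _ _) => *; apply: phase_inj;
  rewrite /= ?(phase_comp, phase_tens, phase_of) ?add0r ?addr0 //.
- by congr ld_comp; apply: esym.
- exact: ld_assoc.
- exact: ld_lunit.
- exact: ld_runit.
Defined.

(* The primitive of f on Z, for the forward difference, vanishing at 0. *)
Definition zsum (f : int -> A) (m : int) : A :=
  match m with
  | Posz n => \sum_(i < n) f (Posz i)
  | Negz n => - \sum_(i < n.+1) f (Negz i)
  end.

Lemma zsum1D f m : zsum f (1 + m) = f m + zsum f m.
Proof.
case: m => [n | [|n]].
- by rewrite -PoszD add1n /= big_ord_recr addrC.
- by rewrite /= big_ord0 big_ord1 subrr.
- by rewrite one_add_Negz /= [in RHS]big_ord_recr opprD addrCA subrr addr0.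
Qed.

(** * A pseudofunctor with loop [x] *)

Section PowerData.
Variable x : G.

(* Forced by associativity once the compositor is normalised to vanish on all
   pairs (1, n). *)
Definition power_comp (m n : int) : A :=
  zsum (fun i => al x (gexpz x i) (gexpz x n)) m - al x 1%g (gexpz x n).

Lemma power_comp1D l n :
  power_comp (1 + l) n = al x (gexpz x l) (gexpz x n) + power_comp l n.
Proof. by rewrite /power_comp zsum1D addrA. Qed.

Lemma power_comp0 n : power_comp 0 n = - al x 1%g (gexpz x n).
Proof. by rewrite /power_comp /= big_ord0 add0r. Qed.

Lemma power_assoc l m n :
  power_comp l (m + n) + power_comp m n
    + al (gexpz x l) (gexpz x m) (gexpz x n)
  = power_comp (l + m) n + power_comp l m.
Proof.
elim/int_step_ind: l => [|l].
  rewrite add0r !power_comp0 gexpzD.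
  have := z3_pentagon al x 1%g (gexpz x m) (gexpz x n).
  rewrite mul1g mulg1 [LHS]addrC addrCA => /addrI e.
  by rewrite -[gexpz x 0]/1%g e opprD [LHS](AC (2*1*1) (3*2*(4*1))) /= subrr addr0.
rewrite -[1 + l + m]addrA !power_comp1D gexpz1D !gexpzD /=.
(* Both sides of the claim grow by the same a1 + a2 from l to 1 + l. *)
have p := z3_pentagon al x (gexpz x l) (gexpz x m) (gexpz x n).
rewrite [X in _ <-> X = _](ACl ((2*3)*(1*4))) /= p.
set a1 := al x _ (gexpz x n); set a2 := al x _ _.
rewrite [X in _ <-> X = _](AC (2*(1*2)) ((1*2*3)*(4*5))) /=.
rewrite [X in _ <-> _ = X](AC (2*2) ((2*4)*(1*3))) /=.
by split=> [-> // | /addIr].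
Qed.

(** The case [n = 0] forces the unitor [al x 1 1], since [al 1 1 1] vanishes. *)
Lemma power_lunit n :
  - al 1%g 1%g (gexpz x n) = power_comp 0 n + al x 1%g 1%g.
Proof. by rewrite power_comp0 (z3_mid1 al x) opprD subrK. Qed.

Definition power_data : loop_data :=
  @LoopData (gexpz x) power_comp (al x 1%g 1%g) erefl (gexpzD x)
    power_assoc power_lunit.
End PowerData.

(** * Transport along conjugation *)

Section Conjugation.
Variable k : G.
Local Notation "a ^*" := (a ^ k^-1)%g.

(* The homotopy between alpha and its pullback along conjugation by k; it is
   what the composition axiom of a transformation with zero phases demands. *)
Definition conj_comp a b : A := al k a b - al (a^*) k b + al (a^*) (b^*) k.

(** An alternating sum of four pentagons, with [k] in each of the four positions around [a], [b],
    [c]; entries to its left are conjugated. *)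
Lemma conj_comp_assoc a b c :
  conj_comp a (b * c)%g + conj_comp b c + al (a^*) (b^*) (c^*)
  = al a b c + (conj_comp (a * b)%g c + conj_comp a b).
Proof.
have p1 := z3_pentagon al k a b c.
have p2 := z3_pentagon al (a^*) k b c.
have p3 := z3_pentagon al (a^*) (b^*) k c.
have p4 := z3_pentagon al (a^*) (b^*) (c^*) k.
rewrite -!conjgCV in p2 p3 p4.
rewrite /conj_comp !conjMg.
apply: (addIr (al (a^*) k (b * c)%g + al (b^*) k c + al (a^* * b^*)%g k c
  + al (a^*) k b + al (k * a)%g b c + al (a^*) (k * b)%g c
  + al (a^*) (b^*) (k * c)%g)).
rewrite [LHS](AC (3*3*1*7)
  (((1*12)*(4*(13*11))*(14*10)*(6*(3*7)))*2*8*5*9)) /= !subrK.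
rewrite [RHS](AC ((1*(3*3))*7)
  (((1*(2*5))*(8*12)*(9*(13*7))*(14*4))*3*10*6*11)) /= !subrK.
by rewrite p1 -p2 p3 -p4.
Qed.

Lemma conj_comp1 b :
  conj_comp 1%g b = al 1%g 1%g b + al k 1%g 1%g + al 1%g 1%g k - al 1%g 1%g (b^*).
Proof.
rewrite /conj_comp conj1g z3_mid1 -!addrA; do 2 congr (_ + _).
apply/eqP; rewrite addrC subr_eq -addrA [X in _ + X]addrC addrA eq_sym subr_eq.
by rewrite addrC -!z3_left1 conjgCV.
Qed.

Variable D : loop_data.

(** The unitor is the one demanded by the unit axiom of a transformation with zero phases. *)
Definition conj_data : loop_data.
Proof.
refine (@LoopData (fun n => (D n)^*)
  (fun m n => ld_comp D m n + conj_comp (D m) (D n))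
  (ld_unit D - al k 1%g 1%g - al 1%g 1%g k) _ _ _ _).
- by rewrite ld_power0 conj1g.
- by move=> m n; rewrite ld_powerD conjMg.
- move=> l m n; rewrite !ld_powerD.
  rewrite [LHS](AC (2*2*1) ((1*3)*(2*4*5))) /= conj_comp_assoc.
  by rewrite addrA ld_assoc [LHS](AC (2*2) ((1*3)*(2*4))).
- move=> n; rewrite ld_power0 conj_comp1 !addrA.
  rewrite [RHS](ACl ((1*6)*2*3*4*5*7*8)) /= -ld_lunit addNr add0r.
  by rewrite [RHS](ACl (3*1*4*2*5)) /= addrK addrK.
Defined.

Definition conj_transformation :
  strong_transformation (loop_pseudofunctor D) (loop_pseudofunctor conj_data).
Proof.
refine (@StrongTransformation _ _ (loop_pseudofunctor D)
  (loop_pseudofunctor conj_data) (fun=> k)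
  (fun _ _ n => gmor_of (esym (conjgCV k (D n))) 0)
  (fun _ _ _ => deloop_Gamma_inv _) _ _ _) => *; apply: phase_inj;
  rewrite /= ?(phase_comp, phase_tens, phase_of) ?add0r ?addr0 //.
by rewrite /conj_comp !addrA.
Defined.
End Conjugation.

(** Replacing targets by conjugates turns any composable pair into some [[h'|h]g]. *)
Lemma eq_at_pair (c c' : Z2 (inertia G) A) :
  (forall h' h g, at_pair c h' h g = at_pair c' h' h g) ->
  forall (x y z : inertia G) (k : ghom y z) (h : ghom x y),
    c _ _ _ k h = c' _ _ _ k h.
Proof.
move=> cc' x y z [k kP] [h hP].
have ey := eqP hP; have ez := eqP kP; subst y; subst z.
have := cc' k h x; rewrite /at_pair /inertia_arrow.
by rewrite (eq_irrelevance kP (eqxx _)) (eq_irrelevance hP (eqxx _)).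
Qed.
End TransgressionFormula.

Theorem theorem8p3 (R : realType) (G : finGroupType) (alpha : Z3 G (U1 R)) :
  (forall (F F' F'' : pseudofunctor BZ (deloop (Gamma alpha)))
      (beta : strong_transformation F F') (beta' : strong_transformation F' F'')
      (n : int),
    component_2cell (comp_transformation beta' beta) n
    = (component_2cell beta' n + component_2cell beta n)
      - at_pair (transgression alpha)
          (component_1cell beta') (component_1cell beta) (gexpz (loop F) n))
  /\
  (forall c : Z2 (inertia G) (U1 R),
    (forall (F F' F'' : pseudofunctor BZ (deloop (Gamma alpha)))
        (beta : strong_transformation F F')
        (beta' : strong_transformation F' F'') (n : int),
      component_2cell (comp_transformation beta' beta) n
      = (component_2cell beta' n + component_2cell beta n)
        - at_pair c
            (component_1cell beta') (component_1cell beta) (gexpz (loop F) n)) ->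
    forall (x y z : inertia G) (k : ghom y z) (h : ghom x y),
      z2fun c k h = z2fun (transgression alpha) k h).
Proof.
split=> [|c Hc]; first exact: comp_transformation_2cell.
apply: eq_at_pair => h' h g.
pose s := conj_transformation h (power_data alpha g).
pose t := conj_transformation h' (conj_data h (power_data alpha g)).
(* Both formulas compute the phase of the same composite, so the common sum cancels. *)
have := Hc _ _ _ s t 1; rewrite comp_transformation_2cell => /addrI/oppr_inj.
by rewrite /loop /= !expg1.
Qed.
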